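(* Let $q\in\mathbb{C}\setminus\{0,1\}$, let $X$ be a nonzero complex Banach space, and let $T,S\in\mathcal{B}(X)$ satisfy $TS=q^{-1}ST$. If $T$ and $S$ are invertible operators, then $\sigma(T,S)=\varnothing$ and $|q|=1$. If $|q|\neq1$, then $\sigma(T,S)$ is a nonempty compact subset of $\mathbb{C}^2$.
   Context: $\mathcal{B}(X)$ is the algebra of bounded linear operators on $X$. Put $\mathbb{C}_x=\mathbb{C}\times\{0\}\subseteq\mathbb{C}^2$, $\mathbb{C}_y=\{0\}\times\mathbb{C}\subseteq\mathbb{C}^2$ and $\mathbb{C}_{xy}=\mathbb{C}_x\cup\mathbb{C}_y$. For $\gamma=(\gamma(x),\gamma(y))\in\mathbb{C}_{xy}$ (so $\gamma(x)\gamma(y)=0$), let $\mathcal{K}((T,S),\gamma)$ be the Banach space complex $$0\to X\xrightarrow{d^0_\gamma}X\oplus X\xrightarrow{d^1_\gamma}X\to0,$$ $$d^0_\gamma(\theta)=\left((\gamma(y)-qS)\theta,\ (T-q\gamma(x))\theta\right),\qquad d^1_\gamma(\xi,\eta)=(T-\gamma(x))\xi+(S-\gamma(y))\eta.$$ The joint (Taylor) spectrum is $\sigma(T,S)=\{\gamma\in\mathbb{C}_{xy}:\mathcal{K}((T,S),\gamma)\text{ is not exact}\}$. Compactness is with respect to the standard topology of $\mathbb{C}^2$. *)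

(* Defs.v *)
From HB Require Import structures.
From mathcomp Require Import all_boot all_order all_algebra.
From mathcomp Require Import all_classical all_reals all_analysis.
From mathcomp Require Export complex.

Set Implicit Arguments.
Unset Strict Implicit.
Unset Printing Implicit Defensive.

Import Order.TTheory GRing.Theory Num.Theory.

Local Open Scope classical_set_scope.
Local Open Scope ring_scope.
Local Open Scope complex_scope.

Section BoundedOperators.
Context {R : realType} {X : normedModType R[i]}.

(* The norm of X takes values in the nonnegative reals seen inside R[i];
   hence the coercion %:C of the real constant M. *)
Definition bounded_op (A : {linear X -> X}) : Prop :=
  exists M : R, forall x : X, `|A x| <= M%:C * `|x|.

Definition invertible_op (A : {linear X -> X}) : Prop :=
  exists B : {linear X -> X}, [/\ bounded_op B, cancel A B & cancel B A].

End BoundedOperators.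

Definition short_exact (R : pzRingType) (U V W : lmodType R)
    (f : U -> V) (g : V -> W) : Prop :=
  [/\ [set u | f u = 0] = [set 0],
      range f = [set v | g v = 0] &
      range g = [set: W] ].

Section TaylorSpectrum.
Context {R : realType}.

(* R[i]^o carries the topology of the modulus, which R[i] itself does not, so
   R[i]^o * R[i]^o is C^2 with its standard topology. The first component of
   a point g is g(x), the second is g(y). *)
Definition Cx : set (R[i]^o * R[i]^o) := [set g | g.2 = 0].
Definition Cy : set (R[i]^o * R[i]^o) := [set g | g.1 = 0].
Definition Cxy : set (R[i]^o * R[i]^o) := Cx `|` Cy.

Context {X : normedModType R[i]}.
Variables (q : R[i]) (T S : {linear X -> X}).

Definition koszul0 (g : R[i]^o * R[i]^o) (x : X) : X * X :=
  (g.2 *: x - q *: S x, T x - (q * g.1) *: x).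

Definition koszul1 (g : R[i]^o * R[i]^o) (u : X * X) : X :=
  (T u.1 - g.1 *: u.1) + (S u.2 - g.2 *: u.2).

Lemma koszul1_koszul0 (hq : q != 0)
    (hTS : forall x, T (S x) = q^-1 *: S (T x))
    (g : R[i]^o * R[i]^o) (hg : Cxy g) (x : X) :
  koszul1 g (koszul0 g x) = 0.
Proof.
case: g hg => a b hg; rewrite /koszul1 /koszul0 /=.
have ab0 : (a : R[i]) * (b : R[i]) = 0.
  by case: hg; rewrite /Cx /Cy /= => e; rewrite e ?mulr0 ?mul0r.
move: (a : R[i]) (b : R[i]) ab0 => {hg}{}a {}b ab0.
rewrite !linearB !linearZ /= hTS !scalerN !opprK !scalerA mulfV// scale1r.
rewrite (mulrCA b) (mulrC b) ab0 mulr0 !scale0r oppr0 add0r addr0 (mulrC a).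
by apply/eqP; rewrite addr_eq0 !opprB addrA addrAC.
Qed.

Definition taylor_spectrum : set (R[i]^o * R[i]^o) :=
  [set g | Cxy g /\ ~ short_exact (koszul0 g) (koszul1 g)].

End TaylorSpectrum.

(* Main.v *)
From HB Require Import structures.
Require Import Defs.
From mathcomp Require Import all_boot all_order all_algebra.
From mathcomp Require Import all_classical all_reals all_analysis.
From mathcomp Require Import ring lra.

Import Order.TTheory GRing.Theory Num.Theory.
Import ComplexField.Normc.
Import numFieldNormedType.Exports.
Local Open Scope classical_set_scope.
Local Open Scope ring_scope.
Local Open Scope complex_scope.
Set Implicit Arguments.
Unset Strict Implicit.
Unset Printing Implicit Defensive.

(** The relation [T S = q^-1 S T] gives [q (T - c) S = S (T - q c)], so the Koszul
    complex at [(c, 0)] is the mapping cone of [S] between the two-term complexes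
    of [T - q c] and [T - c]. Exactness of two of the three (the cone, [T - q c]
    bijective, [T - c] bijective) implies the third. The complex at [(0, c)] is
    obtained by exchanging [T] with [S] and [q] with [q^-1]
    ([koszul_exact_swap]).

    If [S] is invertible, the cone is exact for every [c]; with [T] invertible as
    well, the spectrum is empty. Then [S ^ n] is conjugate to [q ^ n S ^ n] by
    the fixed operator [T], so the norms of [S ^ n] force [|q| = 1]
    ([trivial_of_contractive_conjugation]).

    Let now [|q| <> 1]. The spectrum is bounded because [T - c] and [T - q c] are
    invertible for large [c]. It is closed because exactness of a complex of Banach
    spaces survives small perturbations ([koszul_exact_open]): the open
    mapping theorem provides solutions with bounds, and these remain approximate
    solutions nearby.

    It is nonempty for the following reason. If all the complexes are exact, then
    [T - c] is bijective if and only if [T - q c] is; starting from large [c] and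
    multiplying with powers of [q] or [q^-1], every [T - c] with [c <> 0] is
    bijective, and likewise for [S]. Hence both operators are quasinilpotent
    ([power_rate_of_bounded_below]; this direction of the spectral radius
    formula is proved with roots of unity in place of contour integrals).
    But at the origin exactness says that [T X + S X = X], with bounded lifts. For
    [|q| <= 1], expanding a vector [n] times along this decomposition bounds its
    norm by [C ^ n] times the norms of the operators [T ^ k S ^ l], [k + l = n],
    which decay faster than any geometric sequence; so [X = 0]
    ([quasinilpotent_pair_not_onto]). For [|q| > 1] one expands
    along [S ^ l T ^ k]. *)

(** * Complete norms and approximate solutions *)

Lemma geometric_eventually_le (R : realType) (x K e : R) :
  0 <= x -> x < 1 -> 0 < e ->
  exists n0, forall n, (n0 <= n)%N -> K * x ^+ n <= e.
Proof.
move=> x0 x1 e0.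
have K0 : 0 < `|K| + 1 by rewrite ltr_wpDl.
have d0 : 0 < e / (`|K| + 1) by exact: divr_gt0.
have xn : `|x| < 1 by rewrite ger0_norm.
have /cvgrPdist_le /(_ _ d0) [n0 _ h] := cvg_expr xn.
exists n0 => n /h /=.
rewrite sub0r normrN ger0_norm ?exprn_ge0// ler_pdivlMr// mulrC.
apply: le_trans; apply: ler_wpM2r; first exact: exprn_ge0.
by apply: (le_trans (ler_norm K)); rewrite lerDl.
Qed.

Lemma le_of_geometric_error (R : realType) (a b K : R) :
  (forall n, a <= b + K * 2^-1 ^+ n) -> a <= b.
Proof.
move=> h; apply/ler_addgt0Pr => e e0.
have [||n0 /(_ n0 (leqnn _)) hn] := @geometric_eventually_le R 2^-1 K e _ _ e0.
- by rewrite invr_ge0.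
- by rewrite invf_lt1 ?ltr1n.
by apply: (le_trans (h n0)); rewrite lerD2l.
Qed.

Lemma exists_choice_fun (X Y : Type) (Q : X -> Y -> Prop) :
  (forall x, exists y, Q x y) -> exists f, forall x, Q x (f x).
Proof. by move=> /choice[f hf]; exists f. Qed.

Lemma normc_real (R : realType) (t : R) : normc t%:C = `|t|.
Proof. by rewrite /normc /= expr0n addr0 sqrtr_sqr. Qed.

Lemma normcX (R : realType) (c : R[i]) n : normc (c ^+ n) = normc c ^+ n.
Proof. by elim: n => [|n IH]; rewrite ?expr0 ?normc1// !exprS normcM IH. Qed.

Lemma normc_ge0 (R : realType) (c : R[i]) : 0 <= normc c.
Proof. by case: c => a b; exact: sqrtr_ge0. Qed.

Lemma normc_gt0 (R : realType) (c : R[i]) : c != 0 -> 0 < normc c.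
Proof.
by move=> c0; rewrite lt_def normc_ge0 andbT; apply: contra c0 => /eqP/eq0_normc->.
Qed.

Section BanachNorm.
Context {R : realType}.

Lemma geometric_tail (V : zmodType) (N : V -> R) (u : nat -> V) (K : R) :
  N 0 = 0 -> (forall x y, N (x + y) <= N x + N y) ->
  (forall n, N (u n.+1 - u n) <= K * 2^-1 ^+ n) ->
  forall n k,
    N (u (n + k)%N - u n) <= 2 * K * 2^-1 ^+ n - 2 * K * 2^-1 ^+ (n + k).
Proof.
move=> N0 Ntri hu n; elim=> [|k IH]; first by rewrite addn0 !subrr N0.
have -> : u (n + k.+1)%N - u n =
    (u (n + k).+1 - u (n + k)%N) + (u (n + k)%N - u n).
  by rewrite addnS addrA subrK.
have := Ntri (u (n + k).+1 - u (n + k)%N) (u (n + k)%N - u n).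
have := hu (n + k)%N; rewrite addnS exprS; lra.
Qed.

(** A complete real-valued norm on a complex vector space, as a predicate: both
    X and X * X, with the sum of the norms, are used as Banach spaces, and all
    estimates take place in R instead of the real axis of R[i]. Completeness is
    asked only for sequences with geometrically small steps; by passing to
    subsequences this is equivalent to completeness. *)
Record banach_norm (V : lmodType R[i]) (N : V -> R) : Prop := BanachNorm {
  bn_triangle : forall x y, N (x + y) <= N x + N y;
  bn_scale : forall c x, N (c *: x) = normc c * N x;
  bn_eq0 : forall x, N x = 0 -> x = 0;
  bn_geometric_cvg : forall (u : nat -> V) (K : R),
    (forall n, N (u n.+1 - u n) <= K * 2^-1 ^+ n) ->
    exists l, forall e, 0 < e ->
      exists n0, forall n, (n0 <= n)%N -> N (l - u n) <= e }.

Section Basics.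
Variables (V : lmodType R[i]) (N : V -> R).
Hypothesis hN : banach_norm N.

Lemma bn0 : N 0 = 0.
Proof. by rewrite -(scale0r 0) (bn_scale hN) normc0 mul0r. Qed.

Lemma bnN x : N (- x) = N x.
Proof. by rewrite -scaleN1r (bn_scale hN) normcN normc1 mul1r. Qed.

Lemma bn_ge0 x : 0 <= N x.
Proof. have := bn_triangle hN x (- x); rewrite subrr bn0 bnN; lra. Qed.

Lemma bnB x y : N (x - y) <= N x + N y.
Proof. by rewrite -(bnN y); exact: bn_triangle. Qed.

Lemma bnBC x y : N (x - y) = N (y - x).
Proof. by rewrite -bnN opprB. Qed.

Lemma bn_complete (u : nat -> V) (K : R) :
  (forall n, N (u n.+1 - u n) <= K * 2^-1 ^+ n) ->
  exists l, forall n, N (l - u n) <= 2 * K * 2^-1 ^+ n.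
Proof.
move=> hu; have [l hl] := bn_geometric_cvg hN hu; exists l => n.
have tail := geometric_tail bn0 (bn_triangle hN) hu n.
have K0 : 0 <= K by have := hu 0; rewrite expr0 mulr1; exact/le_trans/bn_ge0.
apply/ler_addgt0Pr => e /hl[n0 /(_ _ (leq_addl n n0)) h].
have := tail n0; have := bn_triangle hN (l - u (n + n0)%N) (u (n + n0)%N - u n).
have : 0 <= 2 * K * 2^-1 ^+ (n + n0).
  by rewrite !mulr_ge0 ?exprn_ge0 ?invr_ge0.
rewrite addrA subrK; lra.
Qed.

End Basics.

(** Solving [A u = v] up to half of the norm of [v], with the remainder again in
    [P], is enough: the remainders are solved in turn and the corrections form a
    geometric series. It yields Neumann series, the open mapping theorem
    and the stability of exactness. *)
Lemma approximate_solutions (U V : lmodType R[i]) (NU : U -> R) (NV : V -> R)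
    (A : {linear U -> V}) (P : set V) (M C : R) :
  banach_norm NU -> banach_norm NV ->
  (forall u, NV (A u) <= M * NU u) -> 0 <= M ->
  (forall v, P v -> exists u,
     [/\ P (v - A u), NU u <= C * NV v & NV (v - A u) <= 2^-1 * NV v]) ->
  0 <= C ->
  forall v, P v -> exists u, A u = v /\ NU u <= 2 * C * NV v.
Proof.
move=> hU hV hA M0 hP C0 v0 Pv0.
have [f hf] : exists f : V -> U, forall v, P v ->
    [/\ P (v - A (f v)), NU (f v) <= C * NV v & NV (v - A (f v)) <= 2^-1 * NV v].
  apply: (exists_choice_fun (Q := fun v u => P v ->
    [/\ P (v - A u), NU u <= C * NV v & NV (v - A u) <= 2^-1 * NV v])) => v.
  by have [/hP[u hu]|nPv] := pselect (P v); [exists u|exists 0 => /nPv].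
pose w n := iter n (fun v => v - A (f v)) v0.
have Pw n : P (w n) by elim: n => //= n /hf[].
have Nw n : NV (w n) <= NV v0 * 2^-1 ^+ n.
  elim: n => [|n IH]; first by rewrite expr0 mulr1.
  have [_ _ h] := hf _ (Pw n); apply: (le_trans h).
  by rewrite exprS mulrCA ler_pM2l ?invr_gt0 ?ltr0n.
pose u n := \sum_(k < n) f (w k).
have Au n : A (u n) = v0 - w n.
  elim: n => [|n IH]; first by rewrite /u big_ord0 linear0 subrr.
  rewrite /u big_ord_recr /= linearD -/(u n) IH.
  by rewrite opprB addrA addrAC.
have [|l hl] := bn_complete hU (u := u) (K := C * NV v0).
  move=> n; rewrite /u big_ord_recr /= addrAC subrr add0r.
  have [_ h _] := hf _ (Pw n); apply: (le_trans h).
  by rewrite -mulrA ler_wpM2l.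
exists l; split; last first.
  by have := hl 0; rewrite /u big_ord0 subr0 expr0 mulr1 mulrA.
apply/eqP; rewrite -subr_eq0; apply/eqP/(bn_eq0 hV)/eqP.
rewrite eq_le (bn_ge0 hV) andbT.
apply: (@le_of_geometric_error _ _ _ (M * (2 * (C * NV v0)) + NV v0)) => n.
rewrite add0r.
have -> : A l - v0 = A (l - u n) - w n.
  by rewrite linearB /= Au -addrA -opprD subrK.
apply: (le_trans (bnB hV _ _)); rewrite mulrDl; apply: lerD => //.
by apply: (le_trans (hA _)); rewrite -mulrA ler_wpM2l.
Qed.

(** The open mapping theorem for a bounded operator whose range is a closed
    subspace [P]. The subspace stays a predicate because it is applied to the
    kernel of a differential. *)
Theorem open_mapping_onto (U V : lmodType R[i]) (NU : U -> R) (NV : V -> R)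
    (A : {linear U -> V}) (P : set V) (M : R) :
  banach_norm NU -> banach_norm NV ->
  (forall u, NV (A u) <= M * NU u) -> 0 <= M ->
  (forall c v w, P v -> P w -> P (c *: v + w)) ->
  (forall l, (forall e, 0 < e -> exists v, P v /\ NV (l - v) <= e) -> P l) ->
  range A = P ->
  exists C, 0 <= C /\ forall v, P v -> exists u, A u = v /\ NU u <= C * NV v.
Proof.
move=> hU hV hA M0 Plin Pcl AP.
have PA u : P (A u) by rewrite -AP; exists u.
have P0 : P 0 by rewrite -(linear0 A).
have PD v w : P v -> P w -> P (v + w).
  by move=> Pv Pw; rewrite -[v]scale1r; exact: Plin.
have PZ c v : P v -> P (c *: v) by move=> Pv; rewrite -[_ *: _]addr0; exact: Plin.
have PB v w : P v -> P w -> P (v - w).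
  by move=> Pv Pw; rewrite -scaleN1r; apply: PD => //; exact: PZ.
(* Category argument: some ball of P is filled densely by the image of a ball
   of U; otherwise nested balls shrink to a point of P outside the range. *)
have [n [x0 [r [Px0 r0 dense]]]] : exists (n : nat) (x : V) (r : R),
    [/\ P x, 0 < r &
     forall y, P y -> NV (y - x) <= r ->
     forall s, 0 < s -> exists u, NU u <= n%:R /\ NV (y - A u) < s].
  apply: contrapT => nodense.
  have avoid n (xr : V * R) : exists y : V * R, P xr.1 -> 0 < xr.2 ->
     [/\ P y.1, 0 < y.2, NV (y.1 - xr.1) <= xr.2 / 2, y.2 <= xr.2 / 2 &
        forall u, NU u <= n%:R -> y.2 < NV (y.1 - A u)].
    case: xr => x r /=; apply: contrapT => /forallNP H.
    apply: nodense; exists n, x, (r / 2).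
    have [Px r0] : P x /\ 0 < r.
      by apply: contrapT => nPx; apply: (H (x, r)) => Px r0; case: nPx.
    split=> //; first by rewrite divr_gt0.
    move=> y Py yx s s0; apply: contrapT => /forallNP nu.
    apply: (H (y, Num.min (s / 2) (r / 2))) => _ _ /=; split => //.
    - by rewrite lt_min !divr_gt0.
    - by rewrite ge_min lexx orbT.
    move=> u hu; have /not_andP[//|/negP] := nu u; rewrite -leNgt => su.
    rewrite gt_min; apply/orP; left; lra.
  have [g hg] : exists g : nat * (V * R) -> V * R,
     forall nxr, P nxr.2.1 -> 0 < nxr.2.2 ->
     [/\ P (g nxr).1, 0 < (g nxr).2, NV ((g nxr).1 - nxr.2.1) <= nxr.2.2 / 2,
        (g nxr).2 <= nxr.2.2 / 2 &
        forall u, NU u <= nxr.1%:R -> (g nxr).2 < NV ((g nxr).1 - A u)].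
    by apply: (exists_choice_fun (Q := fun nxr y => P nxr.2.1 -> 0 < nxr.2.2 ->
     [/\ P y.1, 0 < y.2, NV (y.1 - nxr.2.1) <= nxr.2.2 / 2, y.2 <= nxr.2.2 / 2 &
        forall u, NU u <= nxr.1%:R -> y.2 < NV (y.1 - A u)])) => -[n xr]; exact: avoid.
  (* z n is the n-th nested ball, given by its centre and radius. *)
  pose z n := iteri n (fun k xr => g (k, xr)) (0, 1).
  have zS n : z n.+1 = g (n, z n) by [].
  have hz n : P (z n).1 /\ 0 < (z n).2.
    elim: n => [|n [h1 h2]]; first by [].
    by rewrite zS; have [] := hg (n, z n) h1 h2.
  have hzS n : [/\ NV ((z n.+1).1 - (z n).1) <= (z n).2 / 2,
        (z n.+1).2 <= (z n).2 / 2 &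
        forall u, NU u <= n%:R -> (z n.+1).2 < NV ((z n.+1).1 - A u)].
    by have [h1 h2] := hz n; rewrite zS; have [] := hg (n, z n) h1 h2.
  have rle n : (z n).2 <= 2^-1 ^+ n.
    elim: n => [|n IH]; first by rewrite expr0.
    have [_ h _] := hzS n; rewrite exprS; lra.
  have tail n k : NV ((z (n + k)%N).1 - (z n).1) <= (z n).2 - (z (n + k)%N).2.
    elim: k => [|k IH]; first by rewrite addn0 !subrr (bn0 hV).
    have [h1 h2 _] := hzS (n + k)%N.
    rewrite addnS.
    have -> : (z (n + k).+1).1 - (z n).1 =
        ((z (n + k).+1).1 - (z (n + k)%N).1) + ((z (n + k)%N).1 - (z n).1).
      by rewrite addrA subrK.
    have := bn_triangle hV ((z (n + k).+1).1 - (z (n + k)%N).1)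
      ((z (n + k)%N).1 - (z n).1); lra.
  have [|l hl] := bn_complete hV (u := fun n => (z n).1) (K := 1).
    move=> n; have [h _ _] := hzS n; have := rle n; have [_ ?] := hz n.
    rewrite mul1r; lra.
  have lz n : NV (l - (z n).1) <= (z n).2.
    apply: (@le_of_geometric_error _ _ _ 2) => k.
    have -> : l - (z n).1 = (l - (z (n + k)%N).1) + ((z (n + k)%N).1 - (z n).1).
      by rewrite addrA subrK.
    apply: (le_trans (bn_triangle hV _ _)); rewrite addrC; apply: lerD.
      by apply: (le_trans (tail n k)); rewrite gerBl; have [_ /ltW] := hz (n + k)%N.
    apply: (le_trans (hl _)); rewrite mulr1 ler_pM2l ?ltr0n//.
    by rewrite ler_wiXn2l ?leq_addl ?invr_ge0 ?invf_le1 ?ler1n.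
  have : P l.
    apply: Pcl => e e0.
    have [||n0 /(_ n0 (leqnn _)) hn] := @geometric_eventually_le R 2^-1 1 e _ _ e0.
    - by rewrite invr_ge0.
    - by rewrite invf_lt1 ?ltr1n.
    exists (z n0).1; split; first by have [] := hz n0.
    by apply: (le_trans (lz _)); apply: (le_trans (rle _)); rewrite mul1r in hn.
  rewrite -AP => -[u _ Aul].
  pose n := Num.bound (NU u).
  have [_ _ /(_ u)] := hzS n.
  have /[swap]/[apply] : NU u <= n%:R.
    by apply: ltW; have := archi_boundP (bn_ge0 hU u).
  by rewrite Aul (bnBC hV) ltNge lz.
(* A vector of norm r is a difference of two points of the dense ball, hence the
   image of a vector of norm at most 2n up to r/2. *)
pose C := 8 * n%:R / r.
have C0 : 0 <= C by rewrite /C divr_ge0 ?mulr_ge0// ltW.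
exists (2 * C); split; first by rewrite mulr_ge0.
apply: (approximate_solutions hU hV hA M0 _ C0) => v Pv.
have [v0|v0] := eqVneq (NV v) 0.
  exists 0; rewrite linear0 subr0 v0 (bn0 hU) !mulr0; split => //.
have vp : 0 < NV v by rewrite lt_def v0 (bn_ge0 hV).
pose t := r / NV v; have t0 : 0 < t by rewrite divr_gt0.
have s0 : 0 < r / 4 by rewrite divr_gt0.
have nt : normc t%:C = t by rewrite normc_real gtr0_norm.
have nti : normc t^-1%:C = t^-1 by rewrite normc_real gtr0_norm ?invr_gt0.
have Ntv : NV (t%:C *: v) = r by rewrite (bn_scale hV) nt /t divfK.
have [|u1 [nu1 hu1]] := dense (t%:C *: v + x0) (Plin _ _ _ Pv Px0) _ _ s0.
  by rewrite addrK Ntv.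
have [|u2 [nu2 hu2]] := dense x0 Px0 _ _ s0.
  by rewrite subrr (bn0 hV) ltW.
have e : v - A (t^-1%:C *: (u1 - u2)) =
    t^-1%:C *: ((t%:C *: v + x0 - A u1) - (x0 - A u2)).
  rewrite linearZ linearB /= !scalerBr !scalerDr scalerA -rmorphM.
  rewrite mulVf ?gt_eqF// scale1r.
  set a := _ *: A u1; set b := _ *: A u2; set c := _ *: x0.
  by rewrite -[v in LHS](addrK c) !opprB addrACA [RHS]addrACA [- c - a]addrC.
exists (t^-1%:C *: (u1 - u2)); split.
- by apply: PB.
- rewrite (bn_scale hU) nti.
  have -> : t^-1 = NV v / r by rewrite /t invf_div.
  have := bnB hU u1 u2.
  have -> : C * NV v = NV v / r * (8 * n%:R) by rewrite /C; ring.
  move=> h; apply: ler_wpM2l; first by rewrite divr_ge0 // ltW.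
  have := ler0n R n; lra.
- rewrite e (bn_scale hV) nti.
  have h := bnB hV (t%:C *: v + x0 - A u1) (x0 - A u2).
  have -> : t^-1 = NV v / r by rewrite /t invf_div.
  rewrite -mulrA [2^-1 * _]mulrC ler_pM2l// mulrC ler_pdivrMr//; lra.
Qed.

Corollary open_mapping (U V : lmodType R[i]) (NU : U -> R) (NV : V -> R)
    (A : {linear U -> V}) (M : R) :
  banach_norm NU -> banach_norm NV ->
  (forall u, NV (A u) <= M * NU u) -> 0 <= M ->
  (forall v, exists u, A u = v) ->
  exists C, 0 <= C /\ forall v, exists u, A u = v /\ NU u <= C * NV v.
Proof.
move=> hU hV hA M0 onto.
have [|||C [C0 hC]] := open_mapping_onto (P := setT) hU hV hA M0.
- by [].
- by [].
- by apply/seteqP; split=> v // _; have [u <-] := onto v; exists u.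
by exists C; split=> // v; exact: hC.
Qed.

End BanachNorm.

Section RNorm.
Context {R : realType}.

Definition sum_norm (V : lmodType R[i]) (N : V -> R) (u : V * V) : R :=
  N u.1 + N u.2.

Lemma banach_sum_norm (V : lmodType R[i]) (N : V -> R) :
  banach_norm N -> banach_norm (sum_norm N).
Proof.
move=> hN; split; rewrite /sum_norm.
- move=> x y /=; have := bn_triangle hN x.1 y.1.
  have := bn_triangle hN x.2 y.2; lra.
- by move=> c x /=; rewrite !(bn_scale hN) mulrDr.
- move=> [x y] /= h; have := bn_ge0 hN x; have := bn_ge0 hN y => y0 x0.
  by congr pair; apply: (bn_eq0 hN); lra.
- move=> u K hu.
  have [|l1 h1] := bn_geometric_cvg hN (u := fun n => (u n).1) (K := K).
    by move=> n; apply: le_trans (hu n); rewrite lerDl (bn_ge0 hN).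
  have [|l2 h2] := bn_geometric_cvg hN (u := fun n => (u n).2) (K := K).
    by move=> n; apply: le_trans (hu n); rewrite lerDr (bn_ge0 hN).
  exists (l1, l2) => e e0.
  have e20 : 0 < e / 2 by rewrite divr_gt0.
  have [n1 {}h1] := h1 _ e20; have [n2 {}h2] := h2 _ e20.
  exists (maxn n1 n2) => n; rewrite geq_max => /andP[/h1 + /h2] /=; lra.
Qed.

Definition rnorm (X : normedModType R[i]) (x : X) : R := complex.Re `|x|.

Lemma rnormE (X : normedModType R[i]) (x : X) : `|x| = (rnorm x)%:C.
Proof. by rewrite /rnorm RRe_real// ger0_real. Qed.

Lemma banach_rnorm (X : completeNormedModType R[i]) : banach_norm (@rnorm X).
Proof.
split.
- by move=> x y; rewrite -lecR rmorphD /= -!rnormE; exact: ler_normD.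
- by move=> c x; apply: (@complexI R); rewrite rmorphM /= -!rnormE normrZ.
- by move=> x h; apply/eqP; rewrite -normr_eq0 rnormE h.
have tri (x y : X) : rnorm (x + y) <= rnorm x + rnorm y.
  by rewrite -lecR rmorphD /= -!rnormE; exact: ler_normD.
move=> u K hu.
have K0 : 0 <= K.
  by have := hu 0; rewrite expr0 mulr1; apply: le_trans; rewrite -ler0c -rnormE.
have N0 : @rnorm X 0 = 0 by rewrite /rnorm normr0.
have tail := geometric_tail N0 tri hu.
have : cvg (u @ \oo).
  apply: cauchy_cvg; apply: cauchy_exP => e e0.
  have [r r0 er] : exists2 r : R, 0 < r & e = r%:C.
    exists (complex.Re e); last by rewrite RRe_real// gtr0_real.
    by rewrite -ltcR RRe_real// gtr0_real.
  have [||n0 h] := @geometric_eventually_le R 2^-1 (2 * K) (r / 2) _ _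
    (divr_gt0 r0 (ltr0n _ 2)).
  - by rewrite invr_ge0.
  - by rewrite invf_lt1 ?ltr1n.
  exists (u n0); exists n0 => //= n /= hn.
  rewrite -ball_normE /= er rnormE ltcR.
  have -> : rnorm (u n0 - u n) = rnorm (u n - u n0) by rewrite /rnorm distrC.
  have := tail n0 (n - n0)%N; rewrite subnKC//.
  have : 0 <= 2 * K * 2^-1 ^+ n by rewrite !mulr_ge0 ?exprn_ge0 ?invr_ge0.
  have := h n0 (leqnn _); lra.
move=> /cvg_ex[l ul]; exists l => e e0.
have ec0 : 0 < e%:C by rewrite ltcR.
have /cvgrPdist_le /(_ _ ec0) [n0 _ h] := ul.
by exists n0 => n /h /=; rewrite rnormE lecR.
Qed.

End RNorm.

(** * Compactness and bounds for resolvents on annuli *)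

Section Spectral.
Context {R : realType}.

Definition square (r : R) : set R[i]^o :=
  [set (p.1 +i* p.2 : R[i]^o) | p in `[- r, r] `*` `[- r, r]].

Lemma compact_square (r : R) : compact (square r).
Proof.
apply: continuous_compact; last first.
  exact: compact_setX (@segment_compact _ _ _) (@segment_compact _ _ _).
apply: continuous_subspaceT => -[a b].
apply/cvgrPdist_le => e e0.
have [s s0 es] : exists2 s : R, 0 < s & e = s%:C.
  exists (complex.Re e); last by rewrite RRe_real// gtr0_real.
  by rewrite -ltcR RRe_real// gtr0_real.
have s20 : 0 < s / 2 by rewrite divr_gt0.
have near_id (x : R) : nbhs x [set y | `|x - y| <= s / 2].
  by have /cvgrPdist_le := @cvg_id _ (nbhs x); apply.
exists ([set x | `|a - x| <= s / 2], [set y | `|b - y| <= s / 2]).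
  by split; exact: near_id.
move=> p [/= h1 h2].
rewrite es /=.
have -> : `|(a +i* b : R[i]^o) - (p.1 +i* p.2)| =
    (normc ((a +i* b) - (p.1 +i* p.2)))%:C by [].
rewrite lecR.
have -> : (a +i* b) - (p.1 +i* p.2) = (a - p.1)%:C + (0 +i* (b - p.2)).
  by apply/eqP; rewrite eq_complex /= addr0 add0r !eqxx.
apply: (le_trans (le_normcD _ _)).
by rewrite normc_real /normc expr0n /= add0r sqrtr_sqr; lra.
Qed.

Lemma mem_square (r : R) (c : R[i]^o) : normc c <= r -> square r c.
Proof.
case: c => a b h; exists (a, b) => //=.
have r0 : 0 <= r by apply: le_trans h; exact: sqrtr_ge0.
have sq (x y : R) : `|x| <= normc (x +i* y) /\ `|y| <= normc (x +i* y).
  rewrite /normc; split; rewrite -sqrtr_sqr ler_sqrt ?lerDl ?lerDr ?sqr_ge0 //;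
    by rewrite addr_ge0 ?sqr_ge0.
have [ha hb] := sq a b.
by rewrite /= !in_itv /= -!ler_norml (le_trans ha h) (le_trans hb h).
Qed.

Variables (V : lmodType R[i]) (N : V -> R).
Hypothesis hN : banach_norm N.
Variable T : {linear V -> V}.

(** A lower bound at [c] persists, up to a factor 2, for all [c'] close to [c];
    compactness of the annulus makes it uniform. *)
Lemma uniformly_bounded_below (a r : R) :
  (forall c : R[i], c != 0 -> exists K, forall z, N z <= K * N (T z - c *: z)) ->
  0 < a ->
  exists K, forall c, a <= normc c <= r -> forall z, N z <= K * N (T z - c *: z).
Proof.
move=> hT a0.
pose P (K : R) (c : R[i]^o) := a <= normc c -> forall z, N z <= K * N (T z - c *: z).
case: (proj1 (compact_near_coveringP _) (@compact_square r) R (pinfty_nbhs R) P _)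
  => [|K0 [_ hK]]; last first.
  exists (K0 + 1) => c /andP[ac cr] z.
  by apply: (hK (K0 + 1)) => //; [rewrite ltrDl|exact: mem_square].
move=> c _.
have [ca|ac] := ltP (normc c) a.
  exists (ball c ((a - normc c)%:C), setT).
    by split; [apply: nbhsx_ballx; rewrite ltcR subr_gt0|exact: filterT].
  move=> [c' K] [/= + _].
  rewrite -ball_normE /= -[`|_|]/((normc (c - c'))%:C) ltcR => h1 h2.
  have h3 : normc c' <= normc c + normc (c - c').
    rewrite -[normc (c - c')]normcN opprB.
    by have := le_normcD c (c' - c); rewrite [c + _]addrC subrK.
  by move: h2 => /= h2; lra.
have c0 : c != 0.
  by apply: contraTneq ac => ->; rewrite normc0 -ltNge.
have [K1 hK1] := hT _ c0.
pose K := Num.max K1 1.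
have K0 : 0 < K by rewrite lt_max ltr01 orbT.
have hK z : N z <= K * N (T z - c *: z).
  apply: (le_trans (hK1 z)); apply: ler_wpM2r; first exact: bn_ge0.
  by rewrite le_max lexx.
exists (ball c ((2 * K)^-1%:C), [set L | 2 * K <= L]).
  split; first by apply: nbhsx_ballx; rewrite ltcR invr_gt0 mulr_gt0.
  by exists (2 * K); split; [exact: num_real|move=> x /ltW].
move=> [c' L] [/= + KL].
rewrite -ball_normE /= -[`|_|]/((normc (c - c'))%:C) ltcR => h1 _ z.
have e : T z - c *: z = (T z - c' *: z) - (c - c') *: z.
  by rewrite scalerBl opprB addrA subrK.
have := hK z; rewrite e => h2.
have := bnB hN (T z - c' *: z) ((c - c') *: z); rewrite (bn_scale hN) => h3.
have h4 : K * (normc (c - c') * N z) <= N z / 2.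
  rewrite mulrA [leRHS]mulrC; apply: ler_wpM2r; first exact: bn_ge0.
  have : 2 * K * normc (c - c') <= 1.
    by rewrite mulrC -ler_pdivlMr ?mulr_gt0// mul1r ltW.
  lra.
have h5 : K * N (T z - c *: z) <= K * (N (T z - c' *: z) + normc (c - c') * N z).
  by rewrite e; apply: ler_wpM2l; first exact: ltW.
have h6 : 2 * K * N (T z - c' *: z) <= L * N (T z - c' *: z).
  by apply: ler_wpM2r; first exact: bn_ge0.
rewrite e in h5; lra.
Qed.

End Spectral.

(** * Quasinilpotence from the absence of nonzero spectrum *)

Section Rickart.
Context {R : realType}.

Lemma root_of_minus_one n : (0 < n)%N ->
  exists z : R[i], z ^+ n = -1 /\ normc z = 1.
Proof.
move=> n0; have /= zn := @rootCK (R[i]) n n0 (-1).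
exists (n.-root (-1)); split => //.
have : normc (n.-root (-1) : R[i]) ^+ n = 1.
  by rewrite -normcX zn normcN normc1.
by move/eqP; rewrite (pexpr_eq1 n0) ?normc_ge0// => /eqP.
Qed.

Variables (V : lmodType R[i]) (N : V -> R).
Hypothesis hN : banach_norm N.
Variable T : {linear V -> V}.

Lemma iter_linearD n x y : iter n T (x + y) = iter n T x + iter n T y.
Proof. by elim: n => //= n ->; rewrite linearD. Qed.

Lemma iter_linearZ n c x : iter n T (c *: x) = c *: iter n T x.
Proof. by elim: n => //= n ->; rewrite linearZ. Qed.

Lemma iter_linearB n x y : iter n T (x - y) = iter n T x - iter n T y.
Proof. by rewrite -scaleN1r iter_linearD iter_linearZ scaleN1r. Qed.

(** Closeness of [(1 - T / c)^-1] and [(1 - T / (t c))^-1] on a circle passes to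
    the powers [T ^ (2 ^ m)] with the same constant. Indeed [(1 - A ^ 2)^-1] is
    the mean of [(1 - A)^-1] and [(1 + A)^-1], and for [A = (T / c) ^ n] the
    sign is absorbed by multiplying [c] with an [n]-th root of [-1], which keeps
    it on the circle. *)
Lemma resolvent_power_close (r t D : R) (m : nat) :
  (forall c, normc c = r -> forall w z z',
     z - c^-1 *: T z = w -> z' - (t%:C * c)^-1 *: T z' = w ->
     N (z - z') <= D * N w) ->
  forall c, normc c = r -> forall w z z',
     z - c^-1 ^+ (2 ^ m) *: iter (2 ^ m) T z = w ->
     z' - (t%:C * c)^-1 ^+ (2 ^ m) *: iter (2 ^ m) T z' = w ->
     N (z - z') <= D * N w.
Proof.
move=> base; elim: m => [|m IH] c cr w z z'.
  by rewrite expn0 !expr1; exact: base.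
rewrite expnS mul2n -addnn; set n := (2 ^ m)%N in IH *.
have [zeta [zn z1]] := @root_of_minus_one n (expn_gt0 2 m).
have czr : normc (c * zeta) = r by rewrite normcM z1 mulr1.
have split (d : R[i]) (x : V) :
    x - d ^+ (n + n) *: iter (n + n) T x = w ->
    let y := d ^+ n *: iter n T x in
    (x + y) - d ^+ n *: iter n T (x + y) = w /\
    (x - y) + d ^+ n *: iter n T (x - y) = w.
  move=> <- /=; rewrite exprD iterD iter_linearB iter_linearD iter_linearZ.
  rewrite scalerBr scalerDr !scalerA; split.
    by rewrite opprD addrA addrK.
  by rewrite addrA subrK.
have neg (d : R[i]) : (d * zeta)^-1 ^+ n = - d^-1 ^+ n.
  by rewrite invfM exprMn [zeta^-1 ^+ n]exprVn zn invrN1 mulrN1.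
move=> /split[hz1 hz2] /split[hz1' hz2'].
have h1 := IH c cr w _ _ hz1 hz1'.
have h2 := IH (c * zeta) czr w (z - c^-1 ^+ n *: iter n T z)
  (z' - (t%:C * c)^-1 ^+ n *: iter n T z').
rewrite mulrA !neg !scaleNr !opprK in h2.
have {}h2 := h2 hz2 hz2'.
set a := _ *: _ in h1 h2; set b := _ *: _ in h1 h2.
have e : z - z' = 2^-1%:C *: ((z + a - (z' + b)) + (z - a - (z' - b))).
  have -> : (z + a - (z' + b)) + (z - a - (z' - b)) = (z - z') *+ 2.
    rewrite addrACA -opprD addrACA subrr addr0 [z' + b + _]addrACA subrr addr0.
    by rewrite mulr2n addrACA opprD.
  have half : 2^-1 + 2^-1 = 1 :> R by lra.
  by rewrite mulr2n scalerDr -scalerDl -rmorphD half scale1r.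
rewrite e (bn_scale hN) normc_real ger0_norm ?invr_ge0//.
have := bn_triangle hN (z + a - (z' + b)) (z - a - (z' - b)); lra.
Qed.

Definition power_rate (r : R) :=
  exists K, 0 <= K /\ forall n z, N (iter n T z) <= K * r ^+ n * N z.

(** One power with [|T ^ n| <= r ^ n] controls all the others, by Euclidean
    division of the exponent by [n]. *)
Lemma power_rate_of_one (M r : R) n :
  (forall z, N (T z) <= M * N z) -> 0 <= M -> 0 < r -> (0 < n)%N ->
  (forall z, N (iter n T z) <= r ^+ n * N z) -> power_rate r.
Proof.
move=> hM M0 r0 n0 hn.
have Mk k z : N (iter k T z) <= M ^+ k * N z.
  elim: k => [|k IH]; first by rewrite expr0 mul1r.
  by rewrite exprS -mulrA; apply: (le_trans (hM _)); apply: ler_wpM2l.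
have r1 : 1 <= 1 + M / r by rewrite lerDl divr_ge0 // ltW.
exists ((1 + M / r) ^+ n); split; first exact: exprn_ge0 (le_trans ler01 r1).
move=> m; elim/ltn_ind: m => m IH z.
have [mn|nm] := ltnP m n.
  apply: (le_trans (Mk m z)); apply: ler_wpM2r; first exact: bn_ge0.
  apply: (@le_trans _ _ ((1 + M / r) ^+ m * r ^+ m)).
    rewrite -exprMn; apply: lerXn2r;
      rewrite ?nnegrE ?mulr_ge0 ?(le_trans ler01 r1) ?(ltW r0)//.
    by rewrite mulrDl mul1r divfK ?gt_eqF// lerDr ltW.
  apply: ler_wpM2r; first by rewrite exprn_ge0 // ltW.
  by apply: ler_weXn2l => //; exact: ltnW.
rewrite -(subnK nm) iterD exprD mulrA -mulrA.
apply: (le_trans (IH (m - n)%N _ _)).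
  by rewrite ltn_subrL n0 (leq_trans n0 nm).
apply: ler_wpM2l; last exact: hn.
by rewrite mulr_ge0 ?exprn_ge0 ?(le_trans ler01 r1) ?(ltW r0).
Qed.

End Rickart.

Section Rickart.
Context {R : realType}.

Definition sub_scaled_iter (V : lmodType R[i]) (T : {linear V -> V}) d n (x : V) :=
  x - d *: iter n T x.

Lemma sub_scaled_iter_linear (V : lmodType R[i]) (T : {linear V -> V}) d n :
  linear (@sub_scaled_iter V T d n).
Proof.
move=> a x y; rewrite /sub_scaled_iter iter_linearD iter_linearZ.
by rewrite scalerDr scalerA mulrC -scalerA opprD addrACA -scalerBr.
Qed.

HB.instance Definition _ (V : lmodType R[i]) (T : {linear V -> V}) d n :=
  GRing.isLinear.Build R[i] V V _ (@sub_scaled_iter V T d n)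
    (@sub_scaled_iter_linear V T d n).

Variables (V : lmodType R[i]) (N : V -> R).
Hypothesis hN : banach_norm N.
Variable T : {linear V -> V}.

(** The spectral radius formula without contour integrals, after Rickart. Take
    [r < rho < r'] close to each other. For large [n = 2 ^ m], the operator
    [(T / r') ^ n] is small, so [(1 - (T / r') ^ n)^-1] is close to 1; by
    [resolvent_power_close] a preimage of [w] under [1 - (T / r) ^ n] is
    then also close to [w], which forces [|T ^ n| <= r ^ n]. *)
Lemma power_rate_below (rho K : R) :
  0 < rho ->
  (forall c : R[i], rho / 2 <= normc c <= 2 * rho ->
    forall z, N z <= K * N (T z - c *: z)) ->
  (exists M, 0 <= M /\ forall z, N (T z) <= M * N z) ->
  (forall r, rho < r -> power_rate N T r) ->
  exists r, [/\ 0 < r, r < rho & power_rate N T r].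
Proof.
move=> rho0 bb [M [M0 hM]] above.
wlog K0 : K bb / 0 <= K.
  move=> /(_ (Num.max K 0)); apply; last by rewrite le_max lexx orbT.
  move=> c /bb hc z; apply: (le_trans (hc z)).
  apply: ler_wpM2r; first exact: bn_ge0.
  by rewrite le_max lexx.
(* With d * Q <= 1 the resolvents at radii r and r' differ by at most 1/8. *)
pose Q := 16 * (K + 1) * (1 + 2 * K * rho).
have Kr : 0 <= K * rho by rewrite mulr_ge0 // ltW.
have Q0 : 0 < Q by rewrite !mulr_gt0//; lra.
pose d := Num.min (rho / 2) Q^-1.
have d0 : 0 < d by rewrite lt_min invr_gt0 Q0 andbT divr_gt0.
have dr : d <= rho / 2 by rewrite ge_min lexx.
have dQ : d * Q <= 1 by rewrite -ler_pdivlMr// mul1r ge_min lexx orbT.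
pose r := rho - d; pose r' := rho + d; pose t := r' / r.
have r0 : 0 < r by rewrite /r; lra.
have r'0 : 0 < r' by rewrite /r'; lra.
have base (c : R[i]) : normc c = r -> forall w z z',
     z - c^-1 *: T z = w -> z' - (t%:C * c)^-1 *: T z' = w ->
     N (z - z') <= 8^-1 * N w.
  move=> cr w z z' hz hz'.
  have c0 : c != 0.
    by apply: contraTneq r0 => c0; rewrite -cr c0 normc0 ltxx.
  have c'r : normc (t%:C * c) = r'.
    by rewrite normcM normc_real cr ger0_norm ?divfK ?gt_eqF ?divr_ge0 ?ltW.
  set c' := t%:C * c in hz' c'r *.
  have c'0 : c' != 0.
    by apply: contraTneq r'0 => c'0; rewrite -c'r c'0 normc0 ltxx.
  have res (x : V) a : a != 0 -> x - a^-1 *: T x = w -> T x - a *: x = - (a *: w).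
    by move=> a0 <-; rewrite scalerBr scalerA mulfV// scale1r opprB.
  have hz1 := res z c c0 hz; have hz2 := res z' c' c'0 hz'.
  have dc : normc (c' - c) = 2 * d.
    have -> : c' - c = (t - 1)%:C * c by rewrite rmorphB /= mulrBl mul1r.
    rewrite normcM normc_real cr.
    have -> : t - 1 = 2 * d / r.
      rewrite /t -[X in _ - X](@divff _ r) ?gt_eqF// -mulrBl /r /r'.
      by congr (_ / _); ring.
    by rewrite ger0_norm ?divfK ?gt_eqF// divr_ge0 ?mulr_ge0 ?ltW.
  have e : T (z - z') - c *: (z - z') = (c' - c) *: (w - z').
    have -> : T (z - z') - c *: (z - z') =
        (T z - c *: z) - (T z' - c' *: z') - (c' - c) *: z'.
      rewrite linearB scalerBr scalerBl -[RHS]addrA -opprD subrKA.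
      by rewrite !opprD !opprK addrACA.
    rewrite hz1 hz2 opprK [RHS]scalerBr.
    by congr (_ - _); rewrite addrC scalerBl.
  have h1 := bb c _ (z - z'); rewrite e (bn_scale hN) dc cr in h1.
  have {}h1 : N (z - z') <= K * (2 * d * N (w - z')) by apply: h1; rewrite /r; lra.
  have h2 := bb c' _ z'; rewrite hz2 (bnN hN) (bn_scale hN) c'r in h2.
  have {}h2 : N z' <= K * (r' * N w) by apply: h2; rewrite /r'; lra.
  have h3 := bnB hN w z'.
  have Nw := bn_ge0 hN w.
  apply: (le_trans h1).
  have h4 : N (w - z') <= (1 + 2 * K * rho) * N w.
    have h5 : K * (r' * N w) <= K * (2 * rho * N w).
      by apply: ler_wpM2l => //; apply: ler_wpM2r => //; rewrite /r'; lra.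
    lra.
  have h6 : K * (2 * d * N (w - z')) <=
      (K + 1) * (2 * d * ((1 + 2 * K * rho) * N w)).
    apply: ler_pM => //; [|lra|].
      by rewrite !mulr_ge0 ?(ltW d0)// (bn_ge0 hN).
    by apply: ler_wpM2l => //; rewrite mulr_ge0 // ltW.
  apply: (le_trans h6).
  have -> : (K + 1) * (2 * d * ((1 + 2 * K * rho) * N w)) = d * Q * (8^-1 * N w).
    by rewrite /Q; field.
  by rewrite ler_piMl // mulr_ge0 // invr_ge0.
have [K2 [_ hK2]] : power_rate N T (rho + d / 2) by apply: above; lra.
have x0 : 0 <= (rho + d / 2) / r' by rewrite divr_ge0 ?(ltW r'0)//; lra.
have x1 : (rho + d / 2) / r' < 1 by rewrite ltr_pdivrMr// mul1r /r'; lra.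
have e80 : 0 < (8^-1 : R) by rewrite invr_gt0.
have [m hm] := geometric_eventually_le K2 x0 x1 e80.
pose n := (2 ^ m)%N.
have {hm} small x : N (iter n T x) <= r' ^+ n * (8^-1 * N x).
  apply: (le_trans (hK2 n x)); rewrite mulrA; apply: ler_wpM2r; first exact: bn_ge0.
  have := hm n (ltnW (ltn_expl m (ltnSn 1))).
  by rewrite exprMn exprVn mulrA ler_pdivrMr ?exprn_gt0// [8^-1 * _]mulrC.
exists r; split => //; first by rewrite /r; lra.
apply: (power_rate_of_one hN hM M0 r0 (n := n)); first by rewrite expn_gt0.
move=> z.
pose c : R[i] := r%:C.
have cr : normc c = r by rewrite normc_real gtr0_norm.
have c'r : normc (t%:C * c) = r'.
  by rewrite normcM normc_real cr ger0_norm ?divfK ?gt_eqF ?divr_ge0 ?ltW.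
pose w := z - c^-1 ^+ n *: iter n T z.
have small' x : N ((t%:C * c)^-1 ^+ n *: iter n T x) <= 8^-1 * N x.
  rewrite (bn_scale hN) normcX normcV c'r exprVn mulrC ler_pdivrMr ?exprn_gt0//.
  by rewrite mulrC.
have [||||z' [hz' _]] := @approximate_solutions R V V N N
    (sub_scaled_iter T ((t%:C * c)^-1 ^+ n) n) setT (1 + 8^-1) 1 hN hN _ _ _ _ w I.
- move=> x; apply: (le_trans (bnB hN _ _)); rewrite mulrDl mul1r.
  exact: lerD.
- by rewrite addr_ge0 // ltW.
- move=> v _; exists v; split => //; first by rewrite mul1r.
  rewrite /= /sub_scaled_iter opprB addrC subrK.
  by apply: (le_trans (small' v)); have := bn_ge0 hN v; lra.
- by [].
have h1 := resolvent_power_close hN base cr (erefl w) hz'.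
have h2 : N (z' - w) <= 8^-1 * N z'.
  by rewrite -hz' /= /sub_scaled_iter opprB addrC subrK.
have h3 := bn_triangle hN (z - z') (z' - w).
rewrite addrA subrK in h3.
have h4 := bn_triangle hN w (z' - w); rewrite [w + _]addrC subrK in h4.
have h5 := bnB hN z (z - w); rewrite opprB addrC subrK in h5.
have e : N (iter n T z) = r ^+ n * N (z - w).
  rewrite /w opprB addrC subrK (bn_scale hN) normcX normcV cr mulrA exprVn.
  by rewrite mulfV ?mul1r // expf_neq0 // gt_eqF.
rewrite e; apply: ler_wpM2l; first by rewrite exprn_ge0 // ltW.
have := bn_ge0 hN w; have := bn_ge0 hN z; lra.
Qed.

(** If all [T - c] with [c <> 0] are bounded below, then [T] is quasinilpotent: a
    positive infimum of the rates would be improved by [power_rate_below]. *)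
Theorem power_rate_of_bounded_below :
  (exists M, 0 <= M /\ forall z, N (T z) <= M * N z) ->
  (forall c : R[i], c != 0 -> exists K, forall z, N z <= K * N (T z - c *: z)) ->
  forall r, 0 < r -> power_rate N T r.
Proof.
move=> [M [M0 hM]] bb.
pose G := [set r | 0 < r /\ power_rate N T r].
have up r s : G r -> r <= s -> power_rate N T s.
  move=> [r0 [K [K0 hK]]] rs.
  exists K; split=> // n z; apply: (le_trans (hK n z)).
  apply: ler_wpM2r; first exact: bn_ge0.
  apply: ler_wpM2l => //; apply: lerXn2r => //.
    by rewrite nnegrE ltW.
  by rewrite nnegrE (le_trans (ltW r0) rs).
have Glb : lbound G 0 by move=> r [/ltW].
have Gne : G !=set0.
  exists (M + 1); split; first by rewrite ltr_wpDl.
  apply: (power_rate_of_one hN hM M0 _ (n := 1)) => [|//|z /=].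
    by rewrite ltr_wpDl.
  rewrite expr1; apply: (le_trans (hM z)).
  by apply: ler_wpM2r; rewrite ?(bn_ge0 hN)// lerDl.
have Ginf : has_inf G by split => //; exists 0.
have above s : inf G < s -> power_rate N T s.
  by move=> /(inf_lt Gne)[r Gr /ltW]; exact: up.
have [rho0|rho0] := leP (inf G) 0.
  by move=> r r0; apply: above; exact: le_lt_trans r0.
have [K hK] := uniformly_bounded_below hN (2 * inf G) bb
  (divr_gt0 rho0 (ltr0n _ 2)).
have [|r [r0 rlt rr]] := power_rate_below rho0 hK _ above; first by exists M.
have := ge_inf (proj2 Ginf) (conj r0 rr : G r); lra.
Qed.

End Rickart.

(** * Algebra of the Koszul complex *)

Section KoszulAlgebra.
Context {R : realType} {X : normedModType R[i]}.
Implicit Types (q c : R[i]) (T S : {linear X -> X}) (g : R[i]^o * R[i]^o).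

Lemma koszul0_linear q T S g : linear (koszul0 q T S g).
Proof.
move=> c x y; rewrite /koszul0 !linearP /=; congr pair => /=.
- by rewrite scalerDr addrACA.
- by rewrite scalerDr addrACA.
Qed.

HB.instance Definition _ q T S g :=
  GRing.isLinear.Build R[i] X (X * X)%type _ (koszul0 q T S g)
    (koszul0_linear q T S g).

Lemma koszul1_linear T S g : linear (koszul1 T S g).
Proof.
move=> c x y; rewrite /koszul1 /= !linearP /= !scalerDr.
by rewrite (addrACA (c *: T x.1)) (addrACA (c *: S x.2)) [RHS]addrACA.
Qed.

HB.instance Definition _ T S g :=
  GRing.isLinear.Build R[i] (X * X)%type X _ (koszul1 T S g) (koszul1_linear T S g).

Definition koszul_exact q T S g : Prop :=
  [/\ forall x, koszul0 q T S g x = 0 -> x = 0,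
      forall u, koszul1 T S g u = 0 -> exists x, koszul0 q T S g x = u &
      forall y, exists u, koszul1 T S g u = y].

Lemma short_exactP q T S g :
  q != 0 -> (forall x, T (S x) = q^-1 *: S (T x)) -> Cxy g ->
  short_exact (koszul0 q T S g) (koszul1 T S g) <-> koszul_exact q T S g.
Proof.
move=> q0 hTS hg; split=> [[k e o]|[k e o]]; split.
- by move=> x hx; have : [set 0] x by rewrite -k.
- move=> u hu; have : range (koszul0 q T S g) u; 
    [by rewrite e|by move=> [x _ <-]; exists x].
- move=> y; have : range (koszul1 T S g) y; 
    [by rewrite o|by move=> [u _ <-]; exists u].
- by apply/seteqP; split=> x /=; [exact: k|move=> ->; rewrite linear0].
- apply/seteqP; split=> u /=; first by move=> [x _ <-]; exact: koszul1_koszul0.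
  by move=> /e[x <-]; exists x.
- by apply/seteqP; split=> y //= _; have [u <-] := o y; exists u.
Qed.

(** The complexes of [(T, S)] and [(S, T)] agree up to the flip of the middle
    term and the factor [- q^-1], when [q] becomes [q^-1]. Hence only points of
    the first axis need to be studied. *)
Lemma koszul_exact_swap q T S (a b : R[i]) : q != 0 ->
  koszul_exact q^-1 S T (b, a) -> koszul_exact q T S (a, b).
Proof.
move=> q0 [k e o].
have d0 x : koszul0 q^-1 S T (b, a) x =
    - q^-1 *: ((koszul0 q T S (a, b) x).2, (koszul0 q T S (a, b) x).1).
  rewrite /koszul0 /=; congr pair => /=.
    by rewrite scalerBr scalerA mulNr mulKf// !scaleNr opprK addrC.
  by rewrite scalerBr !scalerA !mulNr mulVf// !scaleNr scale1r opprK addrC.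
have d1 u : koszul1 S T (b, a) (u.2, u.1) = koszul1 T S (a, b) u.
  by rewrite /koszul1 /= addrC.
split.
- by move=> x hx; apply: k; rewrite d0 hx scaler0.
- move=> u hu; have [|x hx] := e (u.2, u.1); first by rewrite d1.
  exists (- q^-1 *: x); apply/eqP; rewrite linearZ /=.
  have := d0 x; rewrite hx.
  by case: (koszul0 q T S (a, b) x) u {hu hx} => [y z] [u v] /= [-> ->].
- by move=> y; have [u <-] := o y; exists (u.2, u.1); rewrite -d1; case: u.
Qed.

Definition shift_op T c (x : X) := T x - c *: x.

Lemma shift_op_linear T c : linear (shift_op T c).
Proof.
move=> a x y; rewrite /shift_op !linearP /= scalerDr.
by rewrite addrACA.
Qed.

HB.instance Definition _ T c :=
  GRing.isLinear.Build R[i] X X _ (shift_op T c) (shift_op_linear T c).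

Definition regular_point T c : Prop :=
  (forall x, T x - c *: x = 0 -> x = 0) /\ (forall y, exists x, T x - c *: x = y).

Section Commutation.
Variables (q : R[i]) (T S : {linear X -> X}).
Hypotheses (q0 : q != 0) (hTS : forall x, T (S x) = q^-1 *: S (T x)).

(** The intertwining [q (T - c) S = S (T - q c)]. By it the complex at [(c, 0)]
    is the mapping cone of [S], seen as a map from the complex of [T - q c] to
    that of [T - c]. The lemmas [koszul_exact_of_regular], [regular_mulq] and
    [regular_divq] are the resulting long exact sequence, in which the exactness
    of two out of three terms gives the third. *)
Lemma commute_resolvent c x : q *: (T (S x) - c *: S x) = S (T x - (q * c) *: x).
Proof.
by rewrite hTS scalerBr !scalerA mulfV// scale1r [RHS]linearB [S (_ *: _)]linearZ.
Qed.

Lemma koszul0_x (a : R[i]) x :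
  koszul0 q T S (a, 0) x = (- (q *: S x), T x - (q * a) *: x).
Proof. by rewrite /koszul0 /= scale0r sub0r. Qed.

Lemma koszul1_x (a : R[i]) u : koszul1 T S (a, 0) u = T u.1 - a *: u.1 + S u.2.
Proof. by rewrite /koszul1 /= scale0r subr0. Qed.

Lemma resolventN (c : R[i]) x : T (- x) - c *: (- x) = - (T x - c *: x).
Proof. by rewrite linearN scalerN opprB opprK addrC. Qed.

Lemma resolventB (c : R[i]) x y :
  T (x - y) - c *: (x - y) = (T x - c *: x) - (T y - c *: y).
Proof. by rewrite linearB scalerBr !opprD !opprK addrACA. Qed.

Lemma resolventZ (c d : R[i]) x : T (d *: x) - c *: (d *: x) = d *: (T x - c *: x).
Proof. by rewrite [T _]linearZ scalerBr !scalerA mulrC. Qed.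

Lemma koszul_exact_of_regular a :
  regular_point T a -> regular_point T (q * a) -> koszul_exact q T S (a, 0).
Proof.
move=> [inja surja] [injqa surjqa]; split.
- by move=> x; rewrite koszul0_x => -[_ /injqa].
- move=> [u v]; rewrite koszul1_x /= => huv.
  have [x hx] := surjqa v; exists x; rewrite koszul0_x hx; congr pair.
  apply/eqP; rewrite -subr_eq0; apply/eqP/inja.
  rewrite resolventB resolventN resolventZ commute_resolvent hx -opprD.
  by rewrite addrC huv oppr0.
- move=> y; have [x <-] := surja y.
  by exists (x, 0); rewrite koszul1_x /= linear0 addr0.
Qed.

Lemma regular_mulq c :
  koszul_exact q T S (c, 0) -> regular_point T c -> regular_point T (q * c).
Proof.
move=> [k e _] [inj surj]; split.
- move=> x hx; apply: k; rewrite koszul0_x hx; congr pair.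
  suff -> : S x = 0 by rewrite scaler0 oppr0.
  apply: inj; apply: (scalerI q0); rewrite commute_resolvent hx linear0.
  by rewrite scaler0.
- move=> y; have [z hz] := surj (- S y).
  have [|x] := e (z, y); first by rewrite koszul1_x /= hz addNr.
  by rewrite koszul0_x => -[_ <-]; exists x.
Qed.

Lemma regular_divq c :
  koszul_exact q T S (c, 0) -> regular_point T (q * c) -> regular_point T c.
Proof.
move=> [_ e o] [inj surj]; split.
- move=> x hx; have [|y] := e (x, 0); first by rewrite koszul1_x /= hx linear0 addr0.
  by rewrite koszul0_x => -[<- /inj->]; rewrite linear0 scaler0 oppr0.
- move=> y; have [[u v]] := o y; rewrite koszul1_x /= => <-.
  have [x <-] := surj v.
  exists (u + q *: S x).
  by rewrite -commute_resolvent -resolventZ linearD scalerDr opprD addrACA.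
Qed.

Lemma koszul_exact_of_bijective S' : cancel S S' -> cancel S' S ->
  forall a, koszul_exact q T S (a, 0).
Proof.
move=> SK KS a; have Sinj := can_inj SK; split.
- move=> x; rewrite koszul0_x => -[/eqP + _].
  rewrite oppr_eq0 scaler_eq0 (negbTE q0) /= => /eqP Sx.
  by apply: Sinj; rewrite Sx linear0.
- move=> [u v]; rewrite koszul1_x /= => huv.
  exists (- q^-1 *: S' u); rewrite koszul0_x [S (_ *: _)]linearZ /= KS.
  rewrite scalerA mulrN mulfV// scaleN1r opprK.
  congr pair; apply: Sinj.
  rewrite -commute_resolvent [S (_ *: _)]linearZ /= KS resolventZ.
  rewrite scalerA mulrN mulfV// scaleN1r.
  by apply/eqP; rewrite eq_sym -addr_eq0 addrC huv.
- move=> y; exists (0, S' y).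
  by rewrite koszul1_x /= linear0 scaler0 subrr add0r KS.
Qed.

Lemma iter_S_T n x : iter n S (T x) = q ^+ n *: T (iter n S x).
Proof.
elim: n => [|n IH] /=; first by rewrite scale1r.
by rewrite IH [S (_ *: _)]linearZ /= hTS scalerA exprSr mulfK.
Qed.

End Commutation.
End KoszulAlgebra.

(** * Stability of exactness *)

Section KoszulAnalysis.
Context {R : realType} {X : completeNormedModType R[i]}.
Implicit Types (q c : R[i]) (T S : {linear X -> X}) (g : R[i]^o * R[i]^o).
Local Notation N := (@rnorm R X).
Local Notation N2 := (sum_norm N).
Let hN : banach_norm N := banach_rnorm X.
Let hN2 : banach_norm N2 := banach_sum_norm hN.

Lemma bounded_op_rnorm T : bounded_op T ->
  exists M, 0 < M /\ forall x, N (T x) <= M * N x.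
Proof.
move=> [M hM]; exists (Num.max M 1); split; first by rewrite lt_max ltr01 orbT.
move=> x; have := hM x; rewrite !rnormE -rmorphM lecR => /le_trans; apply.
by apply: ler_wpM2r; [exact: bn_ge0|rewrite le_max lexx].
Qed.

Lemma bounded_below_of_regular T c : bounded_op T -> regular_point T c ->
  exists K, forall z, N z <= K * N (T z - c *: z).
Proof.
move=> /bounded_op_rnorm[M [M0 hM]] [inj surj].
have [|||C [_ hC]] := @open_mapping R X X N N (shift_op T c) (M + normc c) hN hN.
- move=> u; rewrite /= /shift_op mulrDl -(bn_scale hN).
  by apply: (le_trans (bnB hN _ _)); exact: lerD.
- by rewrite addr_ge0 ?normc_ge0 // ltW.
- exact: surj.
exists C => z; have [x [xz Nx]] := hC (T z - c *: z).
have <- : x = z.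
  by apply/eqP; rewrite -subr_eq0; apply/eqP/inj; rewrite resolventB -xz subrr.
by apply: (le_trans Nx); rewrite -xz.
Qed.

(** Neumann series. *)
Lemma regular_of_large T M c : 0 < M -> (forall x, N (T x) <= M * N x) ->
  2 * M <= normc c -> regular_point T c.
Proof.
move=> M0 hM cM.
have nc0 : 0 < normc c by apply: lt_le_trans cM; rewrite mulr_gt0.
have c0 : c != 0 by apply: contraTneq nc0 => ->; rewrite normc0 ltxx.
have Mc : (normc c)^-1 * M <= 2^-1.
  by rewrite mulrC ler_pdivrMr//; lra.
split.
  move=> x /eqP; rewrite subr_eq0 => /eqP Tx; apply: (bn_eq0 hN).
  have := hM x; rewrite Tx (bn_scale hN) => h.
  have Nx := bn_ge0 hN x.
  have : 2 * M * N x <= M * N x by apply: le_trans h; exact: ler_wpM2r.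
  have : 0 <= M * N x by rewrite mulr_ge0 // ltW.
  move=> h1 h2; have /eqP : M * N x = 0 by lra.
  by rewrite mulf_eq0 gt_eqF //= => /eqP.
move=> y.
have [||||x [xy _]] := @approximate_solutions R X X N N (shift_op T c) setT
  (M + normc c) (normc c)^-1 hN hN _ _ _ _ y I.
- move=> u; rewrite /= /shift_op mulrDl -(bn_scale hN).
  by apply: (le_trans (bnB hN _ _)); exact: lerD.
- by rewrite addr_ge0 ?normc_ge0 // ltW.
- move=> v _; exists (- c^-1 *: v); split=> //.
    by rewrite (bn_scale hN) normcN normcV.
  rewrite /= /shift_op [T _]linearZ scalerA mulrN mulfV// scaleN1r opprK.
  rewrite opprD addrC subrK (bnN hN) (bn_scale hN) normcN normcV.
  have h : (normc c)^-1 * N (T v) <= (normc c)^-1 * (M * N v).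
    by apply: ler_wpM2l; rewrite ?invr_ge0 ?normc_ge0.
  apply: (le_trans h); rewrite mulrA; apply: ler_wpM2r => //; exact: bn_ge0.
- by rewrite invr_ge0 normc_ge0.
by exists x.
Qed.

(** The open mapping theorem gives solutions with bounds at [g0], for both
    differentials. At a nearby [g] the same solutions are approximate ones, and
    [approximate_solutions] corrects them. *)
Lemma koszul_exact_open q T S g0 :
  q != 0 -> (forall x, T (S x) = q^-1 *: S (T x)) ->
  bounded_op T -> bounded_op S -> Cxy g0 -> koszul_exact q T S g0 ->
  exists e, 0 < e /\ forall g, Cxy g -> normc (g.1 - g0.1) <= e ->
    normc (g.2 - g0.2) <= e -> koszul_exact q T S g.
Proof.
move=> q0 hTS /bounded_op_rnorm[Mt [Mt0 hT]] /bounded_op_rnorm[Ms [Ms0 hS]].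
move=> hg0 [k0 e0 o0].
pose M g := Mt + Ms + normc g.1 + normc g.2 + normc q * (Ms + normc g.1).
have M0 g : 0 <= M g.
  by rewrite /M !addr_ge0 ?mulr_ge0 ?addr_ge0 ?normc_ge0 // ltW.
have b0 g x : N2 (koszul0 q T S g x) <= M g * N x.
  rewrite /sum_norm /=.
  have := bnB hN (g.2 *: x) (q *: S x); have := bnB hN (T x) ((q * g.1) *: x).
  rewrite !(bn_scale hN) normcM.
  have h1 : normc q * N (S x) <= normc q * (Ms * N x).
    by apply: ler_wpM2l; rewrite ?normc_ge0.
  have := hT x; have := bn_ge0 hN x => Nx.
  have : 0 <= Ms * N x by rewrite mulr_ge0 // ltW.
  have : 0 <= normc g.1 * N x by rewrite mulr_ge0 // normc_ge0.
  rewrite /M; lra.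
have b1 g u : N (koszul1 T S g u) <= M g * N2 u.
  rewrite /sum_norm /koszul1.
  have := bn_triangle hN (T u.1 - g.1 *: u.1) (S u.2 - g.2 *: u.2).
  have := bnB hN (T u.1) (g.1 *: u.1); have := bnB hN (S u.2) (g.2 *: u.2).
  rewrite !(bn_scale hN); have := hT u.1; have := hS u.2.
  have Nx := bn_ge0 hN u.1; have Ny := bn_ge0 hN u.2.
  have : 0 <= Ms * N u.1 by rewrite mulr_ge0 // ltW.
  have : 0 <= Mt * N u.2 by rewrite mulr_ge0 // ltW.
  have : 0 <= normc g.1 * N u.2 by rewrite mulr_ge0 // normc_ge0.
  have : 0 <= normc g.2 * N u.1 by rewrite mulr_ge0 // normc_ge0.
  have : 0 <= normc q * (Ms + normc g.1) * (N u.1 + N u.2).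
    by rewrite mulr_ge0 ?mulr_ge0 ?addr_ge0 ?normc_ge0 // ltW.
  rewrite /M; lra.
have [C1 [C10 hC1]] := @open_mapping R _ X N2 N (koszul1 T S g0) (M g0)
  hN2 hN (b1 g0) (M0 g0) o0.
have [|||C0 [C00 hC0]] := @open_mapping_onto R X _ N N2 (koszul0 q T S g0)
  [set u | koszul1 T S g0 u = 0] (M g0) hN hN2 (b0 g0) (M0 g0).
- by move=> c v w /= hv hw; rewrite linearP /= hv hw scaler0 addr0.
- move=> l hl /=; apply: (bn_eq0 hN); apply/eqP; rewrite eq_le bn_ge0 // andbT.
  apply/ler_addgt0Pr => e epos; rewrite add0r.
  have ep : 0 < e / (M g0 + 1) by rewrite divr_gt0 // ltr_wpDl.
  have [v [/= hv lv]] := hl _ ep.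
  have -> : koszul1 T S g0 l = koszul1 T S g0 (l - v).
    by rewrite linearB /= hv subr0.
  apply: (le_trans (b1 _ _)); rewrite ler_pdivlMr ?ltr_wpDl// in lv.
  have := bn_ge0 hN2 (l - v); have := M0 g0; lra.
- apply/seteqP; split=> u /=; first by move=> [x _ <-]; exact: koszul1_koszul0.
  by move=> /e0[x <-]; exists x.
pose C := C0 + C1 + 1.
have Cp : 0 < C by rewrite ltr_wpDl ?addr_ge0.
have {}hC1 y : exists u, koszul1 T S g0 u = y /\ N2 u <= C * N y.
  have [u [hu Nu]] := hC1 y; exists u; split=> //; apply: (le_trans Nu).
  by apply: ler_wpM2r; [exact: bn_ge0|rewrite /C; lra].
have {}hC0 u : koszul1 T S g0 u = 0 ->
    exists x, koszul0 q T S g0 x = u /\ N x <= C * N2 u.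
  move=> /hC0 [x [hx Nx]]; exists x; split=> //; apply: (le_trans Nx).
  by apply: ler_wpM2r; [exact: bn_ge0|rewrite /C; lra].
have Q0 : 0 < 8 * C * (1 + normc q).
  by rewrite !mulr_gt0 // ltr_pwDl // normc_ge0.
exists (8 * C * (1 + normc q))^-1; split; first by rewrite invr_gt0.
set e := _^-1 => g hg g1 g2.
have ep : 0 < e by rewrite invr_gt0.
pose d := e * (1 + normc q).
have dC : C * d = 8^-1.
  have q1 : 1 + normc q != 0 by rewrite gt_eqF // ltr_pwDl // normc_ge0.
  have C1' : C != 0 by rewrite gt_eqF.
  by rewrite /d /e; field; rewrite q1 C1'.
have eB (r : R[i]) x : normc r <= e -> N (r *: x) <= e * N x.
  by move=> re; rewrite (bn_scale hN); apply: ler_wpM2r => //; exact: bn_ge0.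
have d0 x : N2 (koszul0 q T S g0 x - koszul0 q T S g x) <= d * N x.
  have -> : koszul0 q T S g0 x - koszul0 q T S g x =
      (- ((g.2 - g0.2) *: x), q *: ((g.1 - g0.1) *: x)).
    congr pair => /=.
      by rewrite opprB addrA subrK -scalerBl -scaleNr opprB.
    by rewrite opprB addrC addrA subrK scalerA mulrBr scalerBl.
  rewrite /sum_norm /= (bnN hN) (bn_scale hN q).
  have h1 : normc q * N ((g.1 - g0.1) *: x) <= normc q * (e * N x).
    by apply: ler_wpM2l; [exact: normc_ge0|exact: eB].
  have := eB _ x g2; rewrite /d; lra.
have d1 u : N (koszul1 T S g0 u - koszul1 T S g u) <= d * N2 u.
  have -> : koszul1 T S g0 u - koszul1 T S g u =
      (g.1 - g0.1) *: u.1 + (g.2 - g0.2) *: u.2.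
    rewrite /koszul1 opprD addrACA; congr (_ + _).
      by rewrite opprB addrC addrA subrK -scalerBl.
    by rewrite opprB addrC addrA subrK -scalerBl.
  apply: (le_trans (bn_triangle hN _ _)).
  have := eB _ u.1 g1; have := eB _ u.2 g2.
  have : 0 <= e * normc q * N2 u.
    by rewrite !mulr_ge0 ?normc_ge0 ?(bn_ge0 hN2)// ltW.
  rewrite /d /sum_norm; lra.
split.
- move=> x hx; have [|x' [xx' Nx']] := hC0 (koszul0 q T S g0 x).
    exact: koszul1_koszul0.
  have {}xx' : x' = x.
    by apply/eqP; rewrite -subr_eq0; apply/eqP/k0; rewrite linearB /= xx' subrr.
  apply: (bn_eq0 hN).
  have := d0 x; rewrite hx subr0 => h; rewrite xx' in Nx'.
  have : C * N2 (koszul0 q T S g0 x) <= C * (d * N x).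
    by apply: ler_wpM2l; first exact: ltW.
  rewrite mulrA dC; have := bn_ge0 hN x; lra.
- move=> u hu; have := @approximate_solutions R X _ N N2 (koszul0 q T S g)
    [set u | koszul1 T S g u = 0] (M g) (2 * C) hN hN2 (b0 g) (M0 g).
  case/(_ _ _ u hu)=> [v /= hv||x [hx _]];
    [|by rewrite mulr_ge0 // ltW|by exists x].
  (* v is moved into the kernel of the differential at g0 by a small w. *)
  have [w [hw Nw]] := hC1 (koszul1 T S g0 v).
  have [|x [hx Nx]] := hC0 (v - w); first by rewrite linearB /= hw subrr.
  have h1 := d1 v; rewrite hv subr0 in h1.
  have h2 : C * N (koszul1 T S g0 v) <= C * (d * N2 v).
    by apply: ler_wpM2l => //; exact: ltW.
  rewrite mulrA dC in h2.
  have Nv := bn_ge0 hN2 v.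
  have h3 := bnB hN2 v w.
  have h4 : C * N2 (v - w) <= C * (9 / 8 * N2 v).
    by apply: ler_wpM2l; [exact: ltW|lra].
  exists x; split.
  - by rewrite linearB /= hv koszul1_koszul0 // subrr.
  - have : 0 <= C * N2 v by rewrite mulr_ge0 // ltW.
    lra.
  have -> : v - koszul0 q T S g x = w + (koszul0 q T S g0 x - koszul0 q T S g x).
    by rewrite hx addrA [w + _]addrC subrK.
  have h5 := bn_triangle hN2 w (koszul0 q T S g0 x - koszul0 q T S g x).
  have h6 := d0 x.
  have h7 : d * N x <= d * (C * (9 / 8 * N2 v)).
    apply: ler_wpM2l; last lra.
    by rewrite mulr_ge0 ?addr_ge0 ?normc_ge0 // ltW.
  rewrite mulrA [d * C]mulrC dC in h7; lra.
- move=> y.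
  have [||u [hu _]] := @approximate_solutions R _ X N2 N (koszul1 T S g) setT
    (M g) C hN2 hN (b1 g) (M0 g) _ _ y I.
  + move=> v _; have [u [hu Nu]] := hC1 v; exists u; split=> //.
    have h1 := d1 u; rewrite hu in h1; apply: (le_trans h1).
    have h2 : d * N2 u <= d * (C * N v).
      by apply: ler_wpM2l => //; rewrite mulr_ge0 ?addr_ge0 ?normc_ge0 // ltW.
    rewrite mulrA [d * C]mulrC dC in h2; have := bn_ge0 hN v; lra.
  + exact: ltW.
  by exists u.
Qed.

End KoszulAnalysis.

(** * The joint spectrum *)

Section SpectrumProperties.
Context {R : realType} {X : completeNormedModType R[i]}.
Implicit Types (q c : R[i]) (T S : {linear X -> X}) (g : R[i]^o * R[i]^o).
Local Notation N := (@rnorm R X).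
Local Notation N2 := (sum_norm N).
Let hN : banach_norm N := banach_rnorm X.
Let hN2 : banach_norm N2 := banach_sum_norm hN.

(** Far out [T - c] is invertible, and the step [c -> q c] contracts the plane to 0,
    so every [c <> 0] is reached. *)
Lemma regular_off_zero q T :
  q != 0 -> normc q < 1 -> bounded_op T ->
  (forall c, regular_point T c -> regular_point T (q * c)) ->
  forall c, c != 0 -> regular_point T c.
Proof.
move=> q0 q1 /bounded_op_rnorm[M [M0 hM]] step c c0.
have nc0 := normc_gt0 c0.
have [n0 /(_ n0 (leqnn _)) hn] :=
  geometric_eventually_le (2 * M) (normc_ge0 q) q1 nc0.
have base : regular_point T (c / q ^+ n0).
  apply: (regular_of_large M0 hM).
  by rewrite normcM normcV normcX ler_pdivlMr // exprn_gt0 // normc_gt0.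
have down k : regular_point T (q ^+ k * (c / q ^+ n0)).
  elim: k => [|k IH]; first by rewrite mul1r.
  by rewrite exprS -mulrA; exact: step.
by have := down n0; rewrite mulrCA mulfV ?mulr1 // expf_neq0.
Qed.

Lemma power_rate_of_koszul_exact q T S :
  q != 0 -> normc q != 1 -> (forall x, T (S x) = q^-1 *: S (T x)) ->
  bounded_op T -> (forall a : R[i], koszul_exact q T S (a, 0)) ->
  forall r, 0 < r -> power_rate N T r.
Proof.
move=> q0 q1 hTS bT ex.
have reg : forall c, c != 0 -> regular_point T c.
  move: q1; rewrite neq_lt => /orP[q1|q1].
    by apply: (regular_off_zero q0 q1 bT) => c; exact: regular_mulq.
  apply: (@regular_off_zero q^-1) => // [||c rc].
  - by rewrite invr_eq0.
  - by rewrite normcV invf_lt1 // (lt_trans ltr01 q1).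
  - by apply: (regular_divq q0 hTS (ex _)); rewrite mulVKf.
apply: power_rate_of_bounded_below => //.
  by have [M [/ltW M0 hM]] := bounded_op_rnorm bT; exists M.
by move=> c /reg; exact: bounded_below_of_regular.
Qed.

(** Writing [z = T u + S v] gives
    [T ^ k S ^ l z = q ^ l T ^ (k + 1) S ^ l u + T ^ k S ^ (l + 1) v], so a bound
    [B] for all [T ^ k S ^ l] with [k + l = n + 1] yields the bound [C B] for
    [k + l = n]. Descending from [n] to [0] costs [C ^ n], which is beaten by
    the decay of the powers of [T] and [S]; hence the identity has norm 0. *)
Lemma quasinilpotent_pair_not_onto q T S :
  q != 0 -> normc q <= 1 -> (forall x, T (S x) = q^-1 *: S (T x)) ->
  (forall r, 0 < r -> power_rate N T r) -> (forall r, 0 < r -> power_rate N S r) ->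
  (exists C, 0 <= C /\ forall y, exists u, T u.1 + S u.2 = y /\ N2 u <= C * N y) ->
  forall x : X, x = 0.
Proof.
move=> q0 q1 hTS prT prS [C [C0 hC]] x.
have step n B : 0 <= B ->
    (forall k l, (k + l = n)%N -> forall x, N (iter k T (iter l S x)) <= B * N x) ->
    forall x, N x <= C ^+ n * B * N x.
  elim: n B => [|n IH] B B0 hB y; first by rewrite mul1r; exact: (hB 0 0).
  rewrite exprSr -[C ^+ n * C * B]mulrA; apply: IH; first by rewrite mulr_ge0.
  move=> k l kl z; have [[u v] [<- Nuv]] := hC z.
  rewrite /=.
  have -> : iter k T (iter l S (T u + S v)) =
      q ^+ l *: iter k.+1 T (iter l S u) + iter k T (iter l.+1 S v).
    rewrite iter_linearD iter_linearD (iter_S_T q0 hTS) iter_linearZ.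
    by rewrite -iterSr [iter l.+1 S v]iterSr.
  have h1 := hB k.+1 l (congr1 succn kl) u.
  have h2 := hB k l.+1; rewrite addnS kl in h2; have {}h2 := h2 erefl v.
  apply: (le_trans (bn_triangle hN _ _)).
  rewrite (bn_scale hN) normcX.
  have h3 : normc q ^+ l * N (iter k.+1 T (iter l S u)) <=
      N (iter k.+1 T (iter l S u)).
    by rewrite ler_piMl ?(bn_ge0 hN) // exprn_ile1 // normc_ge0.
  have h4 : B * N2 (u, v) <= B * (C * N (T u + S v)) by apply: ler_wpM2l.
  move: h4; rewrite /sum_norm /=; lra.
have C10 : 0 < C + 1 by rewrite ltr_wpDl.
pose e := (2 * (C + 1))^-1.
have e0 : 0 < e by rewrite invr_gt0 mulr_gt0.
have [K1 [K10 hK1]] := prT e e0; have [K2 [K20 hK2]] := prS e e0.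
have Ce : C * e <= 2^-1.
  by rewrite /e invfM mulrCA ger_pMr ?invr_gt0// ler_pdivrMr// mul1r lerDl.
apply: (bn_eq0 hN); apply/eqP; rewrite eq_le bn_ge0 // andbT.
apply: (@le_of_geometric_error _ _ _ (K1 * K2 * N x)) => n; rewrite add0r.
apply: (le_trans (step n (K1 * K2 * e ^+ n) _ _ x)).
- by rewrite !mulr_ge0 // exprn_ge0 // ltW.
- move=> k l <- y; apply: (le_trans (hK1 _ _)).
  have -> : K1 * K2 * e ^+ (k + l) * N y = K1 * e ^+ k * (K2 * e ^+ l * N y).
    by rewrite exprD; ring.
  by apply: ler_wpM2l; rewrite ?mulr_ge0 ?exprn_ge0 // ltW.
have -> : C ^+ n * (K1 * K2 * e ^+ n) * N x = K1 * K2 * N x * (C * e) ^+ n.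
  by rewrite exprMn; ring.
apply: ler_wpM2l; first by apply: mulr_ge0; [exact: mulr_ge0|exact: bn_ge0].
by apply: lerXn2r => //; rewrite nnegrE ?invr_ge0 // mulr_ge0 // ltW.
Qed.

Lemma koszul1_bounded_lifts q T S : bounded_op T -> bounded_op S ->
  koszul_exact q T S (0, 0) ->
  exists C, 0 <= C /\ forall y, exists u, T u.1 + S u.2 = y /\ N2 u <= C * N y.
Proof.
move=> /bounded_op_rnorm[Mt [Mt0 hT]] /bounded_op_rnorm[Ms [Ms0 hS]] [_ _ o].
have d1 u : koszul1 T S (0, 0) u = T u.1 + S u.2.
  by rewrite /koszul1 /= !scale0r !subr0.
have [|||C [C0 hC]] := @open_mapping R _ X N2 N (koszul1 T S (0, 0))
  (Mt + Ms) hN2 hN.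
- move=> u; rewrite /= d1 /sum_norm.
  have := bn_triangle hN (T u.1) (S u.2); have := hT u.1; have := hS u.2.
  have := bn_ge0 hN u.1; have := bn_ge0 hN u.2 => p1 p2.
  have : 0 <= Ms * N u.1 by rewrite mulr_ge0 // ltW.
  have : 0 <= Mt * N u.2 by rewrite mulr_ge0 // ltW.
  lra.
- by rewrite addr_ge0 // ltW.
- exact: o.
by exists C; split=> // y; have [u [<- Nu]] := hC y; exists u; rewrite -d1.
Qed.

(** Exactness along both axes makes [T] and [S] quasinilpotent, after which the
    last differential at the origin cannot be onto. For [|q| > 1] the roles of
    [T] and [S] are exchanged. *)
Lemma koszul_not_all_exact q T S :
  q != 0 -> normc q != 1 -> (forall x, T (S x) = q^-1 *: S (T x)) ->
  bounded_op T -> bounded_op S ->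
  (forall g, Cxy g -> koszul_exact q T S g) -> forall x : X, x = 0.
Proof.
move=> q0 q1 hTS bT bS ex.
have hST x : S (T x) = (q^-1)^-1 *: T (S x).
  by rewrite hTS scalerA invrK mulfV // scale1r.
have qV0 : q^-1 != 0 by rewrite invr_eq0.
have ex' (b : R[i]) : koszul_exact q^-1 S T (b, 0).
  by apply: koszul_exact_swap => //; rewrite invrK; apply: ex; right.
have prT : forall r, 0 < r -> power_rate N T r.
  by apply: (power_rate_of_koszul_exact q0 q1 hTS bT) => a; apply: ex; left.
have prS : forall r, 0 < r -> power_rate N S r.
  by apply: (power_rate_of_koszul_exact qV0 _ hST bS ex'); rewrite normcV invr_eq1.
move: q1; rewrite neq_lt => /orP[/ltW q1|q1].
  apply: (quasinilpotent_pair_not_onto q0 q1 hTS prT prS).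
  by apply: (koszul1_bounded_lifts (q := q)) => //; apply: ex; left.
apply: (quasinilpotent_pair_not_onto qV0 _ hST prS prT).
  by rewrite normcV invf_le1 ?ltW // (lt_trans ltr01 q1).
by apply: (koszul1_bounded_lifts (q := q^-1)).
Qed.

(** By [S ^ n y = q ^ n T S ^ n (T' y)], the norm of [S ^ n] is at most
    [|q| ^ n |T| |T'|] times itself. For large [n] this factor is below 1/2, so
    [S ^ n = 0]. *)
Lemma trivial_of_contractive_conjugation q T S T' S' :
  q != 0 -> normc q < 1 -> (forall x, T (S x) = q^-1 *: S (T x)) ->
  bounded_op T -> bounded_op S -> bounded_op T' -> cancel T' T -> cancel S S' ->
  forall x : X, x = 0.
Proof.
move=> q0 q1 hTS /bounded_op_rnorm[Mt [Mt0 hT]] /bounded_op_rnorm[Ms [Ms0 hS]].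
move=> /bounded_op_rnorm[Mi [Mi0 hI]] T'K SK x.
have e0 : 0 < (2^-1 : R) by rewrite invr_gt0.
have [n /(_ n (leqnn _)) hn] :=
  geometric_eventually_le (Mt * Mi) (normc_ge0 q) q1 e0.
have contract y : N (iter n S y) <= normc q ^+ n * Mt * N (iter n S (T' y)).
  rewrite -{1}(T'K y) (iter_S_T q0 hTS) (bn_scale hN) normcX -mulrA.
  by apply: ler_wpM2l; rewrite // exprn_ge0 // normc_ge0.
have Sn k y : N (iter k S y) <= Ms ^+ k * N y.
  elim: k => [|k IH]; first by rewrite expr0 mul1r.
  rewrite exprS -mulrA; apply: (le_trans (hS _)).
  by apply: ler_wpM2l => //; exact: ltW.
have decay k y : N (iter n S y) <= 2^-1 ^+ k * (Ms ^+ n * N y).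
  elim: k y => [|k IH] y; first by rewrite mul1r.
  apply: (le_trans (contract y)).
  have h1 := IH (T' y).
  have h2 : normc q ^+ n * Mt * N (iter n S (T' y)) <=
      normc q ^+ n * Mt * (2^-1 ^+ k * (Ms ^+ n * (Mi * N y))).
    apply: ler_wpM2l; first by rewrite mulr_ge0 ?exprn_ge0 ?normc_ge0 // ltW.
    apply: (le_trans h1); apply: ler_wpM2l; first by rewrite exprn_ge0.
    by apply: ler_wpM2l; rewrite ?exprn_ge0 // ltW.
  apply: (le_trans h2).
  have -> : normc q ^+ n * Mt * (2^-1 ^+ k * (Ms ^+ n * (Mi * N y))) =
     Mt * Mi * normc q ^+ n * (2^-1 ^+ k * (Ms ^+ n * N y)) by ring.
  rewrite exprS -[leRHS]mulrA; apply: ler_wpM2r => //.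
  by rewrite !mulr_ge0 ?exprn_ge0 ?(bn_ge0 hN) // ltW.
have Sinj k y : iter k S y = 0 -> y = 0.
  elim: k => //= k IH h; apply: IH; apply: (can_inj SK); by rewrite h linear0.
apply: (Sinj n); apply: (bn_eq0 hN); apply/eqP; rewrite eq_le bn_ge0 // andbT.
by apply: (@le_of_geometric_error _ _ _ (Ms ^+ n * N x)) => k; rewrite add0r mulrC.
Qed.

(** Far out on the first axis both [T - a] and [T - q a] are invertible. *)
Lemma koszul_exact_x_large q T S :
  q != 0 -> (forall x, T (S x) = q^-1 *: S (T x)) -> bounded_op T ->
  exists r, forall a : R[i], r <= normc a -> koszul_exact q T S (a, 0).
Proof.
move=> q0 hTS /bounded_op_rnorm[M [M0 hM]].
have nq := normc_gt0 q0.
exists (2 * M + 2 * M / normc q) => a ha.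
have h0 : 0 <= 2 * M / normc q by rewrite divr_ge0 ?mulr_ge0 // ltW.
apply: koszul_exact_of_regular => //; apply: (regular_of_large M0 hM); first lra.
rewrite normcM -ler_pdivrMl // mulrC; lra.
Qed.

Lemma taylor_spectrumP q T S g :
  q != 0 -> (forall x, T (S x) = q^-1 *: S (T x)) ->
  taylor_spectrum q T S g <-> Cxy g /\ ~ koszul_exact q T S g.
Proof.
by move=> q0 hTS; split=> -[hg /= h]; split=> // ex; apply: h; apply/short_exactP.
Qed.

Lemma closed_Cxy : closed (@Cxy R).
Proof.
have closed0 : closed [set (0 : R[i]^o)].
  exact: accessible_closed_set1 (hausdorff_accessible (@norm_hausdorff _ _)) _.
apply: closedU.
- have -> : @Cx R = snd @^-1` [set 0] by [].
  by apply: closed_comp closed0 => x _; exact: cvg_snd.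
- have -> : @Cy R = fst @^-1` [set 0] by [].
  by apply: closed_comp closed0 => x _; exact: cvg_fst.
Qed.

Lemma closed_taylor_spectrum q T S :
  q != 0 -> (forall x, T (S x) = q^-1 *: S (T x)) ->
  bounded_op T -> bounded_op S -> closed (taylor_spectrum q T S).
Proof.
move=> q0 hTS bT bS g0 hg0.
have cg0 : Cxy g0.
  apply: closed_Cxy; apply: closure_subset hg0 => g; by case.
apply/taylor_spectrumP => //; split=> // ex.
have [e [e0 he]] := koszul_exact_open q0 hTS bT bS cg0 ex.
have ec0 : 0 < e%:C by rewrite ltcR.
have [g [/taylor_spectrumP[//|//|cg nex] [/= b1 b2]]] :=
  hg0 _ (nbhsx_ballx g0 _ ec0).
apply: nex; apply: he => //.
- move: b1; rewrite -ball_normE /= -[`|_|]/((normc (g0.1 - g.1))%:C) ltcR => /ltW.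
  by rewrite -normcN opprB.
- move: b2; rewrite -ball_normE /= -[`|_|]/((normc (g0.2 - g.2))%:C) ltcR => /ltW.
  by rewrite -normcN opprB.
Qed.

Lemma compact_taylor_spectrum q T S :
  q != 0 -> (forall x, T (S x) = q^-1 *: S (T x)) ->
  bounded_op T -> bounded_op S -> compact (taylor_spectrum q T S).
Proof.
move=> q0 hTS bT bS.
have hST x : S (T x) = (q^-1)^-1 *: T (S x).
  by rewrite hTS scalerA invrK mulfV // scale1r.
have qV0 : q^-1 != 0 by rewrite invr_eq0.
have [r1 h1] := koszul_exact_x_large q0 hTS bT.
have [r2 h2] := koszul_exact_x_large qV0 hST bS.
pose r := Num.max (Num.max r1 r2) 0.
apply: (@subclosed_compact _ _ (square r `*` square r)).
- exact: closed_taylor_spectrum.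
- by apply: compact_setX; exact: compact_square.
move=> [a b] /taylor_spectrumP[//|//|cg nex].
have r0 : 0 <= r by rewrite le_max lexx orbT.
case: cg => /= [b0|a0].
  rewrite /Cx /= in b0; rewrite b0 in nex *.
  split=> /=; apply: mem_square; last by rewrite normc0.
  have [//|/ltW ra] := leP (normc a) r; case: nex.
  by apply: h1; apply: le_trans ra; rewrite !le_max lexx.
rewrite /Cy /= in a0; rewrite a0 in nex *.
split=> /=; apply: mem_square; first by rewrite normc0.
have [//|/ltW ra] := leP (normc b) r; case: nex; apply: koszul_exact_swap => //.
by apply: h2; apply: le_trans ra; rewrite !le_max lexx orbT.
Qed.

End SpectrumProperties.

Theorem proposition4p1 (R : realType) (X : completeNormedModType R[i])
    (q : R[i]) (T S : {linear X -> X})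
    (hq0 : q != 0) (hq1 : q != 1)
    (hX : exists x : X, x != 0)
    (hT : bounded_op T) (hS : bounded_op S)
    (hTS : forall x : X, T (S x) = q^-1 *: S (T x)) :
  (invertible_op T -> invertible_op S ->
     taylor_spectrum q T S = set0 /\ `|q| = 1) /\
  (`|q| != 1 ->
     taylor_spectrum q T S !=set0 /\ compact (taylor_spectrum q T S)).
Proof.
have hST x : S (T x) = (q^-1)^-1 *: T (S x).
  by rewrite hTS scalerA invrK mulfV // scale1r.
have qV0 : q^-1 != 0 by rewrite invr_eq0.
have nq c : `|q| = c%:C <-> normc q = c.
  by rewrite -[`|q|]/((normc q)%:C); split=> [/complexI|->].
split.
  move=> [T' [bT' TK T'K]] [S' [bS' SK S'K]]; split.
    rewrite -subset0 => -[a b] /taylor_spectrumP[//|//|cg]; apply.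
    case: cg; rewrite /Cx /Cy /= => ->.
      exact: (koszul_exact_of_bijective hq0 hTS SK S'K).
    apply: koszul_exact_swap => //.
    exact: (koszul_exact_of_bijective qV0 hST TK T'K).
  apply/(nq 1)/eqP; apply: contraT; rewrite neq_lt.
  case: hX => x /eqP x0 /orP[q1|q1]; case: x0.
    exact: (trivial_of_contractive_conjugation hq0 q1 hTS hT hS bT' T'K SK).
  apply: (trivial_of_contractive_conjugation qV0 _ hST hS hT bS' S'K TK).
  by rewrite normcV invf_lt1 // (lt_trans ltr01 q1).
move=> q1; split; last exact: compact_taylor_spectrum.
have {}q1 : normc q != 1 by apply: contra q1 => /eqP/(nq 1)->.
apply/set0P/eqP => sp0.
have [x /eqP x0] := hX; case: x0.
apply: (koszul_not_all_exact hq0 q1 hTS hT hS) => g cg.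
apply: contrapT => nex; suff : set0 g by [].
by rewrite -sp0; apply/taylor_spectrumP.
Qed.
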